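(* (1) Let $X$ be path connected and let $\Omega X\overset{f}{\hookrightarrow}PX\xrightarrow{g}X$ be the loop-path fibration. Then $(f,g)$ is an $\mathcal{E}$-strict-functor pair, i.e. $\mathcal{E}(g)\copyright\mathcal{E}(f)=\mathcal{E}(g\circ f)$. (2) Let $G\overset{f}{\hookrightarrow}EG\xrightarrow{g}BG$ be the universal principal $G$-bundle for a topological group $G$, where $BG$ is the classifying space of $G$. Then $(f,g)$ is an $\mathcal{E}$-strict-functor pair, i.e. $\mathcal{E}(g)\copyright\mathcal{E}(f)=\mathcal{E}(g\circ f)$.
   Context: Homotopies are free (no base points). $\mathcal{E}(X)$ is the group, under composition, of homotopy classes of homotopy self-equivalences of a space $X$. For a continuous map $f:X\to Y$, $\mathcal{E}(f):=\{([h_X],[h_Y])\in\mathcal{E}(X)\times\mathcal{E}(Y)\mid f\circ h_X\simeq h_Y\circ f\}$. For subgroups $S\subset A\times B$ and $S'\subset B\times C$ of products of groups, $S'\copyright S:=\{(a,c)\in A\times C\mid \exists b\in B,\ (a,b)\in S,\ (b,c)\in S'\}$. For continuous maps $f:X\to Y$, $g:Y\to Z$, the pair $(f,g)$ is called an $\mathcal{E}$-strict-functor pair if $\mathcal{E}(g)\copyright\mathcal{E}(f)=\mathcal{E}(g\circ f)$. $PX$ is the space of paths in $X$ starting at a fixed base point, $g$ is evaluation at the endpoint, and $f$ is the inclusion of the loop space $\Omega X$ as the fiber over the base point. $EG\to BG= EG/G$ is the universal principal $G$-bundle constructed by Milnor (with contractible total space $EG$), and $f$ is the inclusion of $G$ as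 a fiber. *)

(* Defs.v *)
From HB Require Import structures.
From mathcomp Require Import all_boot all_order all_algebra.
From mathcomp Require Import monoid generic_quotient.
From mathcomp Require Import all_classical all_reals topology normedtype.
From mathcomp Require Import homotopy.

Set Implicit Arguments.
Unset Strict Implicit.
Unset Printing Implicit Defensive.

Import Order.TTheory GRing.Theory Num.Theory.
Import numFieldNormedType.Exports.

Local Open Scope classical_set_scope.
Local Open Scope ring_scope.
Local Open Scope quotient_scope.

Section UnitInterval.
Variable R : realType.

Definition unit_interval : Type := set_type (`[0, 1]%classic : set R).

HB.instance Definition _ :=
  Topological.copy unit_interval (set_type (`[0, 1]%classic : set R)).

Definition uval (t : unit_interval) : R := \val t.

Lemma uval_itv (t : unit_interval) : 0 <= uval t <= 1.
Proof. by have := set_valP t; rewrite /= in_itv. Qed.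

Lemma uval_inj : injective uval.
Proof. exact: val_inj. Qed.

Lemma uval_continuous : continuous uval.
Proof. exact: initial_continuous. Qed.

Fact uclip_subproof (x : R) :
  Num.max 0 (Num.min 1 x) \in (`[0, 1]%classic : set R).
Proof.
by rewrite inE /= in_itv /= le_max lexx /= ge_max ler01 /= ge_min lexx.
Qed.

Definition uclip (x : R) : unit_interval :=
  exist (fun y => y \in (`[0, 1]%classic : set R)) _ (uclip_subproof x).

Lemma uclipK (x : R) : 0 <= x <= 1 -> uval (uclip x) = x.
Proof. by case/andP=> x0 x1; rewrite /uval /= min_r // max_r. Qed.

Lemma uclip_continuous : continuous uclip.
Proof.
apply: continuous_comp_initial => x.
have cmin : {for x, continuous ((fun=> 1 : R^o) \min (id : R -> R^o))}.
  by apply: continuous_min; [exact: cvg_cst | exact: cvg_id].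
by apply: (continuous_max _ cmin); exact: cvg_cst.
Qed.

Definition uzero : unit_interval := uclip 0.
Definition uone : unit_interval := uclip 1.

Lemma uval0 : uval uzero = 0. Proof. by rewrite uclipK ?lexx ?ler01. Qed.
Lemma uval1 : uval uone = 1. Proof. by rewrite uclipK ?lexx ?ler01. Qed.

Fact uzero_neq_uone : uzero != uone.
Proof.
apply/eqP => /(congr1 uval); rewrite uval0 uval1 => /eqP.
by rewrite eq_sym oner_eq0.
Qed.

HB.instance Definition _ := isBiPointed.Build unit_interval uzero_neq_uone.

End UnitInterval.

Definition path_connected (R : realType) (X : topologicalType) : Prop :=
  forall x y : X, inhabited {path (unit_interval R) from x to y}.

Lemma continuous_pair (X Y Z : topologicalType) (f : X -> Y) (g : X -> Z) :
  continuous f -> continuous g -> continuous (fun x => (f x, g x)).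
Proof.
by move=> cf cg x; exact: (cvg_pair (cf x) (cg x)).
Qed.

Lemma continuous_compT (X Y Z : topologicalType) (f : X -> Y) (g : Y -> Z) :
  continuous f -> continuous g -> continuous (fun x => g (f x)).
Proof. by move=> cf cg x; apply: continuous_comp; [exact: cf | exact: cg]. Qed.

Section Homotopy.
Variable R : realType.
Local Notation I := (unit_interval R).

Definition homotopic (X Y : topologicalType) (f g : X -> Y) : Prop :=
  exists H : X * I -> Y, [/\ continuous H,
    forall x, H (x, zero) = f x & forall x, H (x, one) = g x].

Lemma homotopic_refl (X Y : topologicalType) (f : X -> Y) :
  continuous f -> homotopic f f.
Proof.
move=> cf; exists (fun z => f z.1); split=> //.
by apply: continuous_compT cf => ?; exact: cvg_fst.
Qed.

Lemma uvalsnd_continuous (X : topologicalType) :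
  continuous (fun z : X * I => uval z.2).
Proof.
by apply: continuous_compT; [move=> ?; exact: cvg_snd | exact: uval_continuous].
Qed.

Lemma reparam_continuous (X Y : topologicalType) (H : X * I -> Y)
    (v : X * I -> R) :
  continuous H -> continuous v -> continuous (fun z => H (z.1, uclip (v z))).
Proof.
move=> cH cv; apply: continuous_compT cH; apply: continuous_pair.
  by move=> ?; exact: cvg_fst.
exact: continuous_compT cv (@uclip_continuous R).
Qed.

Lemma homotopic_sym (X Y : topologicalType) (f g : X -> Y) :
  homotopic f g -> homotopic g f.
Proof.
move=> [H [cH H0 H1]].
exists (fun z => H (z.1, uclip (1 - uval z.2))); split.
- apply: reparam_continuous => // z.
  by apply: (@cvgB R R^o); [exact: cvg_cst | exact: uvalsnd_continuous].
- by move=> x /=; rewrite uval0 subr0 -H1.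
- by move=> x /=; rewrite uval1 subrr -H0.
Qed.

Lemma homotopic_trans (X Y : topologicalType) (f g h : X -> Y) :
  homotopic f g -> homotopic g h -> homotopic f h.
Proof.
move=> [H [cH H0 H1]] [K [cK K0 K1]].
pose v (z : X * I) : R := 2 * uval z.2.
have cv : continuous v.
  by move=> z; apply: (@cvgM R); [exact: cvg_cst | exact: uvalsnd_continuous].
pose A z := H (z.1, uclip (v z)).
pose B z := K (z.1, uclip (v z - 1)).
have cA : continuous A by exact: reparam_continuous.
have cB : continuous B.
  apply: (reparam_continuous cK) => z.
  by apply: (@cvgB R R^o); [exact: cv | exact: cvg_cst].
pose C z := if v z <= 1 then A z else B z.
have agree z : v z = 1 -> A z = B z.
  by move=> vz; rewrite /A /B vz subrr [LHS]H1 -[LHS]K0.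
exists C; split.
- apply/continuous_subspace_setT.
  have -> : [set: X * I] = v @^-1` [set x | x <= 1] `|` v @^-1` [set x | 1 <= x].
    apply/esym/seteqP; split=> // z _ /=.
    by case: (leP (v z) 1) => ?; [left | right; exact: ltW].
  apply: withinU_continuous.
  + by apply: preimage_closed; [exact: in1W | exact: closed_le].
  + by apply: preimage_closed; [exact: in1W | exact: closed_ge].
  + apply: (@subspace_eq_continuous _ _ _ A).
      by move=> z; rewrite inE /from_subspace/= /C => ->.
    exact: continuous_subspaceT.
  + apply: (@subspace_eq_continuous _ _ _ B).
      move=> z; rewrite inE /from_subspace/= /C => vz; case: leP => // vz'.
      by apply/esym/agree/eqP; rewrite eq_le vz vz'.
    exact: continuous_subspaceT.
- move=> x; rewrite /C /A /v /= uval0 mulr0 ler01.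
  exact: H0.
- move=> x; rewrite /C /B /v /= uval1 mulr1 ifF; last by rewrite leNgt ltr1n.
  rewrite -[X in X - _]/(1 + 1) addrK.
  exact: K1.
Qed.

Lemma homotopic_compl (X Y Z : topologicalType) (g : Y -> Z) (f f' : X -> Y) :
  continuous g -> homotopic f f' -> homotopic (g \o f) (g \o f').
Proof.
move=> cg [H [cH H0 H1]]; exists (g \o H).
by split=> [|x|x] /=; [exact: continuous_compT | rewrite H0 | rewrite H1].
Qed.

Lemma homotopic_compr (X Y Z : topologicalType) (f : X -> Y) (g g' : Y -> Z) :
  continuous f -> homotopic g g' -> homotopic (g \o f) (g' \o f).
Proof.
move=> cf [H [cH H0 H1]]; exists (fun z => H (f z.1, z.2)).
split=> [|x|x] /=; [|exact: H0|exact: H1].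
apply: continuous_compT cH; apply: continuous_pair; last by move=> ?; exact: cvg_snd.
by apply: continuous_compT cf => ?; exact: cvg_fst.
Qed.

Definition homotopy_equivalence (X Y : topologicalType) (h : X -> Y) : Prop :=
  continuous h /\
  exists k : Y -> X, [/\ continuous k,
    homotopic (k \o h) idfun & homotopic (h \o k) idfun].

End Homotopy.

Section SelfEquivalences.
Variables (R : realType) (X : topologicalType).

Definition self_equivalence : Type :=
  set_type [set h : X -> X | homotopy_equivalence R h].

HB.instance Definition _ := Choice.on self_equivalence.

Definition mk_se (h : X -> X) (hP : homotopy_equivalence R h) :
    self_equivalence :=
  exist (fun h => h \in [set h : X -> X | homotopy_equivalence R h])
    h (mem_set hP).

Definition se_fun (h : self_equivalence) : X -> X := \val h.
Coercion se_fun : self_equivalence >-> Funclass.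

Lemma seP (h : self_equivalence) : homotopy_equivalence R h.
Proof. exact: set_valP h. Qed.

Lemma se_cts (h : self_equivalence) : continuous h.
Proof. by have [] := seP h. Qed.
Arguments se_cts : clear implicits.

Definition se_homotopic : rel self_equivalence :=
  fun h k => `[< homotopic R h k >].

Fact se_homotopic_refl : reflexive se_homotopic.
Proof. by move=> h; apply/asboolP/homotopic_refl/se_cts. Qed.

Fact se_homotopic_sym : symmetric se_homotopic.
Proof. by move=> h k; apply/asboolP/asboolP; exact: homotopic_sym. Qed.

Fact se_homotopic_trans : transitive se_homotopic.
Proof.
by move=> k h l /asboolP hk /asboolP kl; apply/asboolP; exact: homotopic_trans kl.
Qed.

Canonical se_homotopic_equiv :=
  EquivRel se_homotopic se_homotopic_refl se_homotopic_sym se_homotopic_trans.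

Definition E_group : Type := {eq_quot se_homotopic_equiv}.

HB.instance Definition _ := Choice.on E_group.
HB.instance Definition _ := EqQuotient.on E_group.

Definition hclass (h : self_equivalence) : E_group := \pi_E_group h.

Lemma hclassP (h k : self_equivalence) :
  hclass h = hclass k <-> homotopic R h k.
Proof. by rewrite /hclass; split=> [/eqmodP/asboolP|hk]; [|apply/eqmodP/asboolP]. Qed.

Lemma hclassK (a : E_group) : hclass (repr a) = a.
Proof. exact: reprK. Qed.

Lemma repr_hclass (h : self_equivalence) : homotopic R (repr (hclass h)) h.
Proof. by apply/hclassP; rewrite hclassK. Qed.

Fact se_id_subproof : homotopy_equivalence R (@idfun X).
Proof.
have cid : continuous (@idfun X) by move=> x; exact: cvg_id.
by split=> //; exists idfun; split=> //; exact: homotopic_refl.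
Qed.

Definition se_id : self_equivalence := mk_se se_id_subproof.

Fact se_comp_subproof (h k : self_equivalence) : homotopy_equivalence R (h \o k).
Proof.
have [ch [h' [ch' h'h hh']]] := seP h; have [ck [k' [ck' k'k kk']]] := seP k.
split; first exact: continuous_compT.
exists (k' \o h'); split; first exact: continuous_compT.
- apply: homotopic_trans k'k.
  exact: (homotopic_compl ck' (homotopic_compr ck h'h)).
- apply: homotopic_trans hh'.
  exact: (homotopic_compl ch (homotopic_compr ch' kk')).
Qed.

Definition se_comp (h k : self_equivalence) : self_equivalence :=
  mk_se (se_comp_subproof h k).

Fact se_inv_ex (h : self_equivalence) : exists k : self_equivalence,
  homotopic R (k \o h) idfun /\ homotopic R (h \o k) idfun.
Proof.
have [ch [k [ck kh hk]]] := seP h.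
have kP : homotopy_equivalence R k by split=> //; exists h.
by exists (mk_se kP).
Qed.

Definition se_inv (h : self_equivalence) : self_equivalence :=
  projT1 (cid (se_inv_ex h)).

Lemma se_invP (h : self_equivalence) :
  homotopic R (se_inv h \o h) idfun /\ homotopic R (h \o se_inv h) idfun.
Proof. by rewrite /se_inv; case: cid. Qed.

Definition E_one : E_group := hclass se_id.
Definition E_mul (a b : E_group) : E_group :=
  hclass (se_comp (repr a) (repr b)).
Definition E_inv (a : E_group) : E_group := hclass (se_inv (repr a)).

Lemma hclass_comp (h k : self_equivalence) :
  E_mul (hclass h) (hclass k) = hclass (se_comp h k).
Proof.
apply/hclassP; apply: (@homotopic_trans _ _ _ _ (h \o repr (hclass k))).
  exact: (homotopic_compr (se_cts _) (repr_hclass h)).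
exact: (homotopic_compl (se_cts _) (repr_hclass k)).
Qed.

Fact E_mulA : associative E_mul.
Proof.
move=> a b c; rewrite -[a]hclassK -[b]hclassK -[c]hclassK !hclass_comp.
by apply/hclassP; apply: homotopic_refl; exact: se_cts.
Qed.

Fact E_mul1 : left_id E_one E_mul.
Proof.
move=> a; rewrite -[a]hclassK hclass_comp.
by apply/hclassP; apply: homotopic_refl; exact: se_cts.
Qed.

Fact E_mulr1 : right_id E_one E_mul.
Proof.
move=> a; rewrite -[a]hclassK hclass_comp.
by apply/hclassP; apply: homotopic_refl; exact: se_cts.
Qed.

Fact E_mulV : left_inverse E_one E_inv E_mul.
Proof.
move=> a; rewrite -{2}[a]hclassK hclass_comp.
by apply/hclassP; exact: (se_invP _).1.
Qed.

Fact E_mulrV : right_inverse E_one E_inv E_mul.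
Proof.
move=> a; rewrite -{1}[a]hclassK hclass_comp.
by apply/hclassP; exact: (se_invP _).2.
Qed.

HB.instance Definition _ :=
  isGroup.Build E_group E_mulA E_mul1 E_mulr1 E_mulV E_mulrV.

End SelfEquivalences.
Arguments se_cts {R X} h.

(* Meant for continuous f; it is then a subgroup, see [E_map_subgroup]. *)
Definition E_map (R : realType) (X Y : topologicalType)
    (f : X -> Y) : set (E_group R X * E_group R Y) :=
  [set ab | exists (hX : self_equivalence R X) (hY : self_equivalence R Y),
    ab = (hclass hX, hclass hY) /\ homotopic R (f \o hX) (hY \o f)].
Arguments E_map R {X Y} f.

Definition is_subgroup2 (A B : groupType) (S : set (A * B)) : Prop :=
  [/\ S (1, 1)%g,
      forall x y, S x -> S y -> S (x.1 * y.1, x.2 * y.2)%g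
    & forall x, S x -> S (x.1^-1, x.2^-1)%g].

Lemma E_map_subgroup (R : realType) (X Y : topologicalType)
  (f : X -> Y) : continuous f -> is_subgroup2 (E_map R f).
Proof.
move=> cf; split.
- exists (se_id R X), (se_id R Y); split=> //.
  by apply: homotopic_refl; exact: cf.
- move=> _ _ [hX [hY [-> fh]]] [kX [kY [-> fk]]] /=.
  exists (se_comp hX kX), (se_comp hY kY); split.
    by congr pair; exact: hclass_comp.
  apply: (@homotopic_trans _ _ _ _ (hY \o (f \o kX))).
    exact: (homotopic_compr (se_cts kX) fh).
  exact: (homotopic_compl (se_cts hY) fk).
- move=> _ [hX [hY [-> fh]]] /=.
  exists (se_inv (repr (hclass hX))), (se_inv (repr (hclass hY))); split=> //.
  set pX := repr (hclass hX); set pY := repr (hclass hY).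
  have fp : homotopic R (f \o pX) (pY \o f).
    apply: (homotopic_trans (homotopic_compl cf (repr_hclass hX))).
    apply: (homotopic_trans fh); apply: homotopic_sym.
    exact: (homotopic_compr cf (repr_hclass hY)).
  have [_ XV] := se_invP pX; have [YV _] := se_invP pY.
  apply: (@homotopic_trans _ _ _ _ (se_inv pY \o (pY \o f) \o se_inv pX)).
    have := homotopic_compr cf YV; move/(homotopic_compr (se_cts (se_inv pX))).
    exact: homotopic_sym.
  apply: (@homotopic_trans _ _ _ _ (se_inv pY \o ((f \o pX) \o se_inv pX))).
    apply: (homotopic_compl (se_cts _)); apply: homotopic_sym.
    exact: (homotopic_compr (se_cts _) fp).
  apply: (homotopic_compl (se_cts _)).
  exact: (homotopic_compl cf XV).
Qed.

Definition rel_circ (A B C : groupType) (S' : set (B * C)) (S : set (A * B)) :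
    set (A * C) :=
  [set ac | exists b : B, S (ac.1, b) /\ S' (b, ac.2)].

Definition E_strict_functor_pair (R : realType) (X Y Z : topologicalType)
    (f : continuousType X Y) (g : continuousType Y Z) : Prop :=
  rel_circ (E_map R g) (E_map R f) = E_map R (g \o f).

Section PathSpace.
Variables (R : realType) (X : topologicalType) (x0 : X).
Local Notation I := (unit_interval R).

Definition path_space : Type :=
  set_type [set p : {compact-open, I -> X} |
    continuous (p : I -> X) /\ p zero = x0].

HB.instance Definition _ := Topological.copy path_space
  (set_type [set p : {compact-open, I -> X} |
    continuous (p : I -> X) /\ p zero = x0]).

Definition path_eval (p : path_space) : X := \val p one.

Fact path_eval_continuous : continuous path_eval.
Proof.
apply/continuousP => O oO.
exists [set p : {compact-open, I -> X} | p @` [set one] `<=` O].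
  by apply: compact_open_open => //; exact: compact_set1.
by apply/seteqP; split=> p /=; [move/(_ (\val p one)); apply; exists one
                              | move=> ? _ [_ -> <-]].
Qed.

HB.instance Definition _ :=
  isContinuous.Build path_space X path_eval path_eval_continuous.

Definition loop_space : Type := set_type (path_eval @^-1` [set x0]).

HB.instance Definition _ :=
  Topological.copy loop_space (set_type (path_eval @^-1` [set x0])).

Definition loop_incl (p : loop_space) : path_space := \val p.

Fact loop_incl_continuous : continuous loop_incl.
Proof. exact: initial_continuous. Qed.

HB.instance Definition _ :=
  isContinuous.Build loop_space path_space loop_incl loop_incl_continuous.

End PathSpace.

HB.mixin Record isTopologicalGroup G of Group G & Topological G := {
  mulg_continuous : continuous (fun xy : G * G => (xy.1 * xy.2)%g);
  invg_continuous : continuous (fun x : G => x^-1%g)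
}.

#[short(type="topologicalGroupType")]
HB.structure Definition TopologicalGroup :=
  {G of isTopologicalGroup G & Group G & Topological G}.

Section Milnor.
Variables (R : realType) (G : topologicalGroupType).

(* Points of Milnor's infinite join G * G * ... as formal sums
   t_0 g_0 + t_1 g_1 + ..., before forgetting the label g_i when t_i = 0. *)
Record join_repr := JoinRepr {
  jweight : nat -> R;
  jlabel : nat -> G;
  jweight_ge0 : forall i, 0 <= jweight i;
  jweight_sum : exists n, (forall i, (n <= i)%N -> jweight i = 0) /\
                          \sum_(i < n) jweight i = 1
}.

HB.instance Definition _ := gen_eqMixin join_repr.
HB.instance Definition _ := gen_choiceMixin join_repr.

Definition join_rel : rel join_repr := fun e e' =>
  `[< (forall i, jweight e i = jweight e' i) /\
      (forall i, jweight e i != 0 -> jlabel e i = jlabel e' i) >].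

Fact join_rel_refl : reflexive join_rel.
Proof. by move=> e; apply/asboolP. Qed.

Fact join_rel_sym : symmetric join_rel.
Proof.
by move=> e e'; apply/asboolP/asboolP => -[w l]; split=> // i;
  rewrite ?w // => wi; rewrite l // ?w // -w.
Qed.

Fact join_rel_trans : transitive join_rel.
Proof.
move=> e e1 e2 /asboolP[w1 l1] /asboolP[w2 l2]; apply/asboolP; split=> i.
  by rewrite w1.
by move=> wi; rewrite l1 // l2 // -w1.
Qed.

Canonical join_equiv :=
  EquivRel join_rel join_rel_refl join_rel_sym join_rel_trans.

Definition EG : Type := {eq_quot join_equiv}.

HB.instance Definition _ := Choice.on EG.
HB.instance Definition _ := EqQuotient.on EG.

Definition weight (e : EG) (i : nat) : R := jweight (repr e) i.

(* Meaningful only when [weight e i] is nonzero. *)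
Definition label (e : EG) (i : nat) : G := jlabel (repr e) i.

Lemma repr_EG (e : join_repr) : join_rel (repr (\pi_EG e)) e.
Proof. by apply/eqmodP; rewrite reprK. Qed.

Lemma weight_pi (e : join_repr) i : weight (\pi_EG e) i = jweight e i.
Proof. by have /asboolP[w _] := repr_EG e; exact: w. Qed.

Lemma label_pi (e : join_repr) i :
  jweight e i != 0 -> label (\pi_EG e) i = jlabel e i.
Proof.
move=> wi; have /asboolP[w l] := repr_EG e.
by apply: l; rewrite w.
Qed.

Lemma EG_eqP (e e' : EG) :
  (forall i, weight e i = weight e' i) ->
  (forall i, weight e i != 0 -> label e i = label e' i) -> e = e'.
Proof.
by move=> w l; rewrite -[e]reprK -[e']reprK; apply/eqmodP/asboolP; split.
Qed.

(* The coarsest topology making every [weight ^~ i] continuous and every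
   [label ^~ i] continuous on the (then open) set where [weight ^~ i] is
   nonzero. *)
Definition EG_subbase : set (set EG) :=
  [set A | exists (i : nat) (U : set R), open U /\
     A = [set e | U (weight e i)]] `|`
  [set A | exists (i : nat) (V : set G), open V /\
     A = [set e | weight e i != 0 /\ V (label e i)]].

HB.instance Definition _ := isSubBaseTopological.Build EG EG_subbase id.

Definition jact (e : join_repr) (g : G) : join_repr :=
  @JoinRepr (jweight e) (fun i => jlabel e i * g)%g
    (jweight_ge0 e) (jweight_sum e).

Definition EG_act (e : EG) (g : G) : EG := \pi_EG (jact (repr e) g).

Lemma weight_act e g i : weight (EG_act e g) i = weight e i.
Proof. exact: weight_pi. Qed.

Lemma label_act e g i :
  weight e i != 0 -> label (EG_act e g) i = (label e i * g)%g.
Proof. by move=> we; rewrite label_pi. Qed.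

Lemma EG_act1 e : EG_act e 1%g = e.
Proof.
apply: EG_eqP => i; rewrite weight_act // => wi.
by rewrite label_act // mulg1.
Qed.

Lemma EG_actM e g h : EG_act e (g * h)%g = EG_act (EG_act e g) h.
Proof.
apply: EG_eqP => i; rewrite !weight_act // => wi.
by rewrite !label_act ?weight_act // mulgA.
Qed.

Definition orbit_rel : rel EG := fun e e' => `[< exists g, e' = EG_act e g >].

Fact orbit_rel_refl : reflexive orbit_rel.
Proof. by move=> e; apply/asboolP; exists 1%g; rewrite EG_act1. Qed.

Fact orbit_rel_sym : symmetric orbit_rel.
Proof.
by move=> e e'; apply/asboolP/asboolP => -[g ->]; exists (g^-1)%g;
  rewrite -EG_actM mulgV EG_act1.
Qed.

Fact orbit_rel_trans : transitive orbit_rel.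
Proof.
move=> e e1 e2 /asboolP[g ->] /asboolP[h ->]; apply/asboolP.
by exists (g * h)%g; rewrite EG_actM.
Qed.

Canonical orbit_equiv :=
  EquivRel orbit_rel orbit_rel_refl orbit_rel_sym orbit_rel_trans.

Definition BG : Type := quotient_topology {eq_quot orbit_equiv}.

HB.instance Definition _ :=
  Topological.copy BG (quotient_topology {eq_quot orbit_equiv}).

Definition EG_proj (e : EG) : BG := \pi_(quotient_topology {eq_quot orbit_equiv}) e.

Fact EG_proj_continuous : continuous EG_proj.
Proof. exact: pi_continuous. Qed.

HB.instance Definition _ := isContinuous.Build EG BG EG_proj EG_proj_continuous.

Lemma continuous_EG (T : topologicalType) (f : T -> EG) :
  (forall i (U : set R), open U -> open [set x | U (weight (f x) i)]) ->
  (forall i (V : set G), open V ->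
     open [set x | weight (f x) i != 0 /\ V (label (f x) i)]) ->
  continuous f.
Proof.
move=> fw fl; apply/continuousP => _ [D sD <-].
rewrite preimage_bigcup; apply: bigcup_open => A /sD [F sF <-].
rewrite preimage_bigcap openE => x Fx; apply: filter_bigI => B FB.
apply: open_nbhs_nbhs; split; last exact: Fx.
by have /set_mem [] := sF _ FB => -[i [U [oU ->]]]; [exact: fw | exact: fl].
Qed.

(* The fibre of [EG_proj] through [e] is the orbit of [e]. *)
Definition fiber_incl (e : EG) (g : G) : EG := EG_act e g.

Fact fiber_incl_continuous (e : EG) : continuous (fiber_incl e).
Proof.
apply: continuous_EG => [i U oU|i V oV].
  suff -> : [set g | U (weight (fiber_incl e g) i)] = [set _ | U (weight e i)].
    have [Ue|nUe] := pselect (U (weight e i)).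
      by suff -> : [set _ : G | U (weight e i)] = setT; [exact: openT | apply/seteqP; split].
    by suff -> : [set _ : G | U (weight e i)] = set0; [exact: open0 | apply/seteqP; split].
  by apply/funext => g /=; rewrite weight_act.
have [we|we] := eqVneq (weight e i) 0.
  suff -> : [set g | weight (fiber_incl e g) i != 0 /\ V (label (fiber_incl e g) i)]
            = set0 by exact: open0.
  by apply/seteqP; split=> // g /=; rewrite weight_act we eqxx => -[].
pose m (x : G * G) := (x.1 * x.2)%g.
suff -> : [set g | weight (fiber_incl e g) i != 0 /\ V (label (fiber_incl e g) i)]
          = (fun g => m (label e i, g)) @^-1` V.
  apply: open_comp => // g _; move: g.
  apply: (@continuous_compT _ _ _ (fun g : G => (label e i, g)) m).
    by apply: continuous_pair => x; [exact: cvg_cst | exact: cvg_id].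
  exact: mulg_continuous.
apply/seteqP; split=> g /=; rewrite weight_act label_act //.
by case.
Qed.

HB.instance Definition _ (e : EG) :=
  isContinuous.Build G EG (fiber_incl e) (@fiber_incl_continuous e).

End Milnor.

Arguments EG_proj R G e : clear implicits.
Arguments fiber_incl {R G} e g.

(* Main.v *)
Require Import Defs.
From mathcomp Require Import all_boot all_order all_algebra.
From mathcomp Require Import all_classical all_reals topology normedtype.

Set Implicit Arguments.
Unset Strict Implicit.
Unset Printing Implicit Defensive.

Import Order.TTheory GRing.Theory Num.Theory.
Import numFieldNormedType.Exports.

Local Open Scope classical_set_scope.
Local Open Scope ring_scope.
Local Open Scope quotient_scope.

(** In both fibrations the total space [Y] is contractible and the fibre [X] is
    nonempty.  The statement follows for all continuous maps [f : X -> Y] and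
    [g : Y -> Z] with these two properties.

    The inclusion of the composite of [E(g)] and [E(f)] in [E(g \o f)] is formal:
    paste the two homotopy-commutative squares.  Conversely, suppose that
    [g \o f \o hX ~ hZ \o g \o f], and take the identity of [Y] as the middle
    self-equivalence.  The square over [f] commutes up to homotopy because any
    two maps into [Y] are homotopic.  For the square over [g], contract [Y]: [g]
    and [hZ \o g] become constant maps, whose values can be chosen to be
    [g (f (hX x))] and [hZ (g (f x))] for a point [x] of [X]; the given homotopy,
    followed at [x], is a path between these two points of [Z].  This is
    [contractible_strict_functor_pair].

    The path space is contracted by shrinking each path to its origin
    ([path_space_contractible]); continuity for the compact-open topology is the
    exponential law for the compact Hausdorff interval.

    Milnor's infinite join is contracted in two steps ([EG_contractible]).  Let
    [shift] send [t_0 g_0 + t_1 g_1 + ...] to the same formal sum with every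
    summand moved to the next slot, so that slot [0] becomes free.  The join
    parameter between [shift e] and a fixed vertex in slot [0] gives a homotopy
    from [shift] to a constant.  A homotopy from the identity to [shift] moves
    the summands to the next slot one at a time, starting, so to speak, from
    infinity: slot [i] is emptied while the time runs from [2^-(i+1)] to [2^-i].
    There are infinitely many moves, but at time close to [0] a given slot is not
    yet affected, and the topology of [EG] tests continuity slot by slot. *)

(** * Contractible total spaces *)

Definition contractible (R : realType) (Y : topologicalType) : Prop :=
  exists y : Y, homotopic R (@idfun Y) (fun=> y).

Section Contractible.
Variables (R : realType) (Y : topologicalType).
Hypothesis Ycontr : contractible R Y.

Lemma homotopic_to_contractible (X : topologicalType) (f g : X -> Y) :
  continuous f -> continuous g -> homotopic R f g.
Proof.
have [y idy] := Ycontr; move=> cf cg.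
apply: homotopic_trans (homotopic_compr cf idy) _.
exact: homotopic_sym (homotopic_compr cg idy).
Qed.

Lemma homotopic_from_contractible (Z : topologicalType) (g : Y -> Z) (y : Y) :
  continuous g -> homotopic R g (fun=> g y).
Proof.
move=> cg; apply: (homotopic_compl cg (homotopic_to_contractible _ _)).
  by move=> ?; exact: cvg_id.
by move=> ?; exact: cvg_cst.
Qed.

Lemma homotopic_at (X Z W : topologicalType) (f g : X -> Z) (x : X) :
  homotopic R f g -> homotopic R (fun _ : W => f x) (fun=> g x).
Proof.
by apply: (@homotopic_compr _ W X Z (fun=> x)) => ?; exact: cvg_cst.
Qed.

(** Evaluation at the point [x] turns the homotopy between maps from [X] to [Z]
    into a path in [Z]; this path links the constant maps to which [g] and
    [hZ \o g] contract. *)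
Lemma contractible_strict_functor_pair (X Z : topologicalType)
    (f : continuousType X Y) (g : continuousType Y Z) (x : X) :
  E_strict_functor_pair R f g.
Proof.
have cf : continuous f by exact: cts_fun.
have cg : continuous g by exact: cts_fun.
apply/seteqP; split=> [[a c] [b [/= [hX [hY [[-> bE] fh]]]]]|].
  move=> [kY [hZ [[kE ->] gh]]]; exists hX, hZ; split=> //.
  (* The two representatives of the middle class need not be equal. *)
  have hk : homotopic R hY kY by apply/hclassP; rewrite -bE -kE.
  apply: (@homotopic_trans _ _ _ _ (g \o (kY \o f))).
    apply: (homotopic_compl cg); apply: homotopic_trans fh _.
    exact: homotopic_compr hk.
  exact: (homotopic_compr cf gh).
move=> _ [hX [hZ [-> gfh]]].
have hid := @se_cts R Y (se_id R Y).
exists (hclass (se_id R Y)); split.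
  exists hX, (se_id R Y); split=> //=.
  by apply: homotopic_to_contractible => //; apply: continuous_compT => //; exact: se_cts.
exists (se_id R Y), hZ; split=> //=.
have chg : continuous (hZ \o g) by apply: continuous_compT => //; exact: se_cts.
apply: homotopic_trans (homotopic_from_contractible (f (hX x)) cg) _.
apply: (@homotopic_trans _ _ _ _ (fun=> hZ (g (f x)))).
  exact: (@homotopic_at _ _ Y _ _ x gfh).
apply: homotopic_sym; exact: (homotopic_from_contractible (f x) chg).
Qed.

End Contractible.

(** * The path space *)

Section RealValued.
Variables (R : realType) (T : topologicalType).

Lemma continuous_subr (f g : T -> R) :
  continuous f -> continuous g -> continuous (fun x => f x - g x).
Proof. by move=> cf cg x; apply: (@cvgB R R^o); [exact: cf | exact: cg]. Qed.

Lemma continuous_addr (f g : T -> R) :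
  continuous f -> continuous g -> continuous (fun x => f x + g x).
Proof. by move=> cf cg x; apply: (@cvgD R R^o); [exact: cf | exact: cg]. Qed.

Lemma continuous_mulr (f g : T -> R) :
  continuous f -> continuous g -> continuous (fun x => f x * g x).
Proof. by move=> cf cg x; apply: (@cvgM R); [exact: cf | exact: cg]. Qed.

End RealValued.

Section PathSpace.
Variables (R : realType) (X : topologicalType) (x0 : X).
Local Notation I := (unit_interval R).
Local Notation PX := (path_space R x0).

Lemma unit_interval_compact : compact [set: I].
Proof.
have -> : [set: I] = @uclip R @` `[0, 1]%classic.
  apply/seteqP; split=> // t _; exists (uval t).
    by rewrite /= in_itv /= uval_itv.
  by apply: uval_inj; rewrite uclipK ?uval_itv.
apply: continuous_compact; last exact: segment_compact.
by apply: continuous_subspaceT; exact: uclip_continuous.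
Qed.

Lemma unit_interval_hausdorff : hausdorff_space I.
Proof.
move=> s t st; apply: uval_inj; apply: (@norm_hausdorff R R^o) => A B As Bt.
have [u [Au Bu]] := st _ _ (@uval_continuous R s _ As) (@uval_continuous R t _ Bt).
by exists (uval u).
Qed.

Lemma path_val_continuous (p : PX) : continuous (\val p : I -> X).
Proof. by have [] := set_valP p. Qed.

Lemma path_val0 (p : PX) : (\val p : I -> X) zero = x0.
Proof. by have [] := set_valP p. Qed.

(** Evaluation is continuous because the interval is locally compact and
    Hausdorff: this is one half of the exponential law. *)
Lemma path_apply_continuous :
  continuous (fun ps : PX * I => (\val ps.1 : I -> X) ps.2).
Proof.
rewrite (_ : (fun ps => _) = uncurry (fun p : PX => (\val p : I -> X))); last first.
  by apply/funext => -[].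
apply: continuous_uncurry.
- move=> t _; exists setT; first exact: filterT.
  by split; [exact: unit_interval_compact | exact: closedT].
- exact: unit_interval_hausdorff.
- exact: initial_continuous.
- exact: path_val_continuous.
Qed.

(** Only the initial part of the path, up to parameter [1 - t], is still run
    through at time [t]. *)
Definition shrink (t s : I) : I := uclip (uval s * (1 - uval t)).

Lemma shrink_continuous : continuous (fun ts : I * I => shrink ts.1 ts.2).
Proof.
apply: continuous_compT (@uclip_continuous R).
apply: continuous_mulr; first exact: uvalsnd_continuous.
apply: continuous_subr; first exact: cst_continuous.
by apply: (continuous_compT _ (@uval_continuous R)) => ?; exact: cvg_fst.
Qed.

Lemma shrink_at0 (s : I) : shrink zero s = s.
Proof.
by apply: uval_inj; rewrite /shrink (uval0 R) subr0 mulr1 uclipK ?uval_itv.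
Qed.

Lemma shrink_at1 (s : I) : shrink one s = zero.
Proof. by rewrite /shrink (uval1 R) subrr mulr0. Qed.

Lemma shrink_zero (t : I) : shrink t zero = zero.
Proof. by rewrite /shrink (uval0 R) mul0r. Qed.

Definition mk_path (p : I -> X) (cp : continuous p) (p0 : p zero = x0) : PX :=
  exist (fun p : {compact-open, I -> X} =>
    p \in [set p : {compact-open, I -> X} | continuous (p : I -> X) /\ p zero = x0])
    p (mem_set (conj cp p0)).

Fact shrink_path_cts (pt : PX * I) :
  continuous (fun s => (\val pt.1 : I -> X) (shrink pt.2 s)).
Proof.
apply: continuous_compT (@path_val_continuous _).
apply: (@continuous_compT _ _ _ (fun s => (pt.2, s))) shrink_continuous.
by apply: continuous_pair => ?; [exact: cst_continuous | exact: cvg_id].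
Qed.

Fact shrink_path0 (pt : PX * I) : (\val pt.1 : I -> X) (shrink pt.2 zero) = x0.
Proof. by rewrite shrink_zero path_val0. Qed.

Definition shrink_path (pt : PX * I) : PX :=
  mk_path (@shrink_path_cts pt) (shrink_path0 pt).

Lemma shrink_path_continuous : continuous shrink_path.
Proof.
(* By the exponential law it is enough that the value of the shrunk path depends
   jointly continuously on the path, the time and the parameter. *)
apply: continuous_comp_initial.
pose F (pts : (PX * I) * I) := (\val pts.1.1 : I -> X) (shrink pts.1.2 pts.2).
apply: (@continuous_curry_fun _ _ _ F).
have cfst : continuous (fun pts : (PX * I) * I => pts.1) by move=> ?; exact: cvg_fst.
have cpath : continuous (fun pts : (PX * I) * I => pts.1.1).
  by apply: (continuous_compT cfst) => ?; exact: cvg_fst.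
have ctime : continuous (fun pts : (PX * I) * I => (pts.1.2, pts.2)).
  apply: continuous_pair; last by move=> ?; exact: cvg_snd.
  by apply: (continuous_compT cfst) => ?; exact: cvg_snd.
have cshrink := continuous_compT ctime shrink_continuous.
exact: (continuous_compT (continuous_pair cpath cshrink) path_apply_continuous).
Qed.

Definition const_path : PX :=
  @mk_path (fun=> x0) (@cst_continuous _ _ x0) erefl.

Lemma path_space_contractible : contractible R PX.
Proof.
exists const_path, shrink_path; split; first exact: shrink_path_continuous.
- by move=> p; apply: val_inj; apply/funext => s /=; rewrite shrink_at0.
- by move=> p; apply: val_inj; apply/funext => s /=; rewrite shrink_at1 path_val0.
Qed.

Definition const_loop : loop_space R x0 :=
  exist (fun p => p \in (@path_eval R X x0) @^-1` [set x0])
    const_path (mem_set (erefl x0)).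

End PathSpace.

(** * Milnor's infinite join *)

Section MilnorSpace.
Variables (R : realType) (G : topologicalGroupType).
Local Notation I := (unit_interval R).
Local Notation E := (EG R G).

Lemma open_EG_subbase (A : set E) : EG_subbase A -> open A.
Proof.
move=> sA; exists [set A]; last by rewrite bigcup_set1.
by move=> _ ->; exact: finI_from1.
Qed.

Lemma weight_continuous i : continuous (fun e : E => weight e i).
Proof. by apply/continuousP => U oU; apply: open_EG_subbase; left; exists i, U. Qed.

Lemma open_label i (V : set G) : open V ->
  open [set e : E | weight e i != 0 /\ V (label e i)].
Proof. by move=> oV; apply: open_EG_subbase; right; exists i, V. Qed.

Definition finite_mass1 (w : nat -> R) : Prop :=
  exists n, (forall i, (n <= i)%N -> w i = 0) /\ \sum_(i < n) w i = 1.

Lemma weight_ge0 (e : E) i : 0 <= weight e i.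
Proof. exact: jweight_ge0. Qed.

Lemma weight_mass1 (e : E) : finite_mass1 (weight e).
Proof. exact: jweight_sum. Qed.

Lemma EG_ex (w : nat -> R) (l : nat -> G) :
    (forall i, 0 <= w i) -> finite_mass1 w ->
  exists h : E, weight h =1 w /\ forall i, w i != 0 -> label h i = l i.
Proof.
move=> w0 w1; exists (\pi_(EG R G) (JoinRepr l w0 w1)); split=> i.
  exact: weight_pi.
by move=> wi; rewrite label_pi.
Qed.

(** [h] is the formal sum [p e + q e'] with coefficients depending on the slot.
    A label is prescribed only by a summand of nonzero weight; if both are
    nonzero in one slot, [e] and [e'] must have the same label there. *)
Definition combination (p q : nat -> R) (e e' h : E) : Prop := forall i,
  [/\ weight h i = p i * weight e i + q i * weight e' i,
      p i * weight e i != 0 -> label h i = label e i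
    & q i * weight e' i != 0 -> label h i = label e' i].

Lemma combination_ex (p q : nat -> R) (e e' : E) :
    (forall i, 0 <= p i) -> (forall i, 0 <= q i) ->
    (forall i, p i * weight e i = 0 \/ q i * weight e' i = 0) ->
    finite_mass1 (fun i => p i * weight e i + q i * weight e' i) ->
  exists h, combination p q e e' h.
Proof.
move=> p0 q0 pq0 mass.
have w0 i : 0 <= p i * weight e i + q i * weight e' i.
  by rewrite addr_ge0 // mulr_ge0 // weight_ge0.
pose l i := if p i * weight e i == 0 then label e' i else label e i.
have [h [wh lh]] := EG_ex l w0 mass.
exists h => i; split=> // wi.
  rewrite lh /l; first by rewrite (negbTE wi).
  by have [/eqP|->] := pq0 i; [rewrite (negbTE wi) | rewrite addr0].
have pi0 : p i * weight e i = 0.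
  by have [//|/eqP] := pq0 i; rewrite (negbTE wi).
by rewrite lh /l pi0 ?eqxx // add0r.
Qed.

Lemma combination_unique (p q : nat -> R) (e e' h k : E) :
  combination p q e e' h -> combination p q e e' k -> h = k.
Proof.
move=> ch ck; apply: EG_eqP => i; have [wh lh lh'] := ch i; have [wk lk lk'] := ck i.
  by rewrite wh wk.
rewrite wh; have [->|pi _] := eqVneq (p i * weight e i) 0.
  by rewrite add0r => qi; rewrite lh' // lk'.
by rewrite lh // lk.
Qed.

(** Weights of the sum are sums of weights.  Nonnegativity of the two terms means
    that no cancellation occurs: a slot of the sum is occupied, with its label in
    an open set [V], exactly when this holds for one of the two terms, so that
    this condition defines a union of two open sets. *)
Lemma combination_continuous (T : topologicalType) (p q : T -> nat -> R)
    (e e' h : T -> E) :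
    (forall i, continuous (fun x => p x i)) ->
    (forall i, continuous (fun x => q x i)) ->
    (forall x i, 0 <= p x i) -> (forall x i, 0 <= q x i) ->
    continuous e -> continuous e' ->
    (forall x, combination (p x) (q x) (e x) (e' x) (h x)) ->
  continuous h.
Proof.
move=> cp cq p0 q0 ce ce' ch.
have cw (f : T -> E) (r : T -> nat -> R) i :
    continuous f -> (forall i, continuous (fun x => r x i)) ->
    continuous (fun x => r x i * weight (f x) i).
  move=> cf cr; apply: continuous_mulr; first exact: cr.
  exact: (continuous_compT cf (@weight_continuous i)).
have ol (f : T -> E) (r : T -> nat -> R) i V :
    continuous f -> (forall i, continuous (fun x => r x i)) -> open V ->
    open [set x | r x i * weight (f x) i != 0 /\ V (label (f x) i)].
  move=> cf cr oV.
  suff -> : [set x | r x i * weight (f x) i != 0 /\ V (label (f x) i)] =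
      (fun x => r x i) @^-1` [set y | y != 0] `&`
      f @^-1` [set e | weight e i != 0 /\ V (label e i)].
    apply: openI; apply: open_comp.
    - by move=> ? _; exact: cr.
    - exact: open_neq.
    - by move=> ? _; exact: cf.
    - exact: open_label.
  apply/seteqP; split=> x /=; rewrite mulf_eq0 negb_or; last by move=> [-> [-> ?]].
  by case=> /andP[-> ->].
apply: continuous_EG => [i U oU|i V oV].
  suff -> : [set x | U (weight (h x) i)] =
      (fun x => p x i * weight (e x) i + q x i * weight (e' x) i) @^-1` U.
    by apply: open_comp => // x _; apply: continuous_addr; exact: cw.
  by apply/funext => x /=; have [-> _ _] := ch x i.
suff -> : [set x | weight (h x) i != 0 /\ V (label (h x) i)] =
    [set x | p x i * weight (e x) i != 0 /\ V (label (e x) i)] `|`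
    [set x | q x i * weight (e' x) i != 0 /\ V (label (e' x) i)].
  by apply: openU; exact: ol.
apply/seteqP; split=> x /=; have [wh lh lh'] := ch x i.
  rewrite wh; have [->|pi [_]] := eqVneq (p x i * weight (e x) i) 0.
    by rewrite add0r => -[qi]; rewrite lh' //; right.
  by rewrite lh //; left.
have w0 : 0 <= p x i * weight (e x) i by rewrite mulr_ge0 ?weight_ge0.
have w0' : 0 <= q x i * weight (e' x) i by rewrite mulr_ge0 ?weight_ge0.
rewrite wh paddr_eq0 // negb_and.
by case=> -[wi Vl]; [rewrite lh // wi | rewrite lh' // wi orbT].
Qed.

(** Every homotopy below arises by varying the coefficients of a combination.
    The ends [h] and [k] need only satisfy the relation at times [0] and [1],
    since a combination is determined by its coefficients and its terms. *)
Lemma combination_homotopic (p q : I -> nat -> R) (f f' h k : E -> E) :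
    (forall i, continuous (fun t => p t i)) ->
    (forall i, continuous (fun t => q t i)) ->
    (forall t i, 0 <= p t i) -> (forall t i, 0 <= q t i) ->
    continuous f -> continuous f' ->
    (forall t e i, p t i * weight (f e) i = 0 \/ q t i * weight (f' e) i = 0) ->
    (forall t e, finite_mass1
       (fun i => p t i * weight (f e) i + q t i * weight (f' e) i)) ->
    (forall e, combination (p zero) (q zero) (f e) (f' e) (h e)) ->
    (forall e, combination (p one) (q one) (f e) (f' e) (k e)) ->
  homotopic R h k.
Proof.
move=> cp cq p0 q0 cf cf' pq0 mass comb0 comb1.
have [H HP] := choice (fun z : E * I =>
  combination_ex (p0 z.2) (q0 z.2) (pq0 z.2 z.1) (mass z.2 z.1)).
have cfst : continuous (@fst E I) by move=> ?; exact: cvg_fst.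
have csnd : continuous (@snd E I) by move=> ?; exact: cvg_snd.
exists H; split.
- apply: combination_continuous HP; try by move=> *; auto.
  + by move=> i; exact: (continuous_compT csnd (cp i)).
  + by move=> i; exact: (continuous_compT csnd (cq i)).
  + exact: continuous_compT cf.
  + exact: continuous_compT cf'.
- by move=> e; exact: combination_unique (HP (e, zero)) (comb0 e).
- by move=> e; exact: combination_unique (HP (e, one)) (comb1 e).
Qed.

(** The point of the shift is the free slot [0]: there is room in it for the
    vertex to which the join is contracted. *)
Lemma shift_ex (e : E) : exists h : E,
  [/\ weight h 0 = 0, forall i, weight h i.+1 = weight e i
    & forall i, weight e i != 0 -> label h i.+1 = label e i].
Proof.
have [n [wn w1]] := weight_mass1 e.
have [||h [wh lh]] := @EG_ex (fun i => if i is j.+1 then weight e j else 0)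
                            (fun i => label e i.-1).
- by case=> // i; exact: weight_ge0.
- by exists n.+1; split=> [[|i] //|]; [exact: wn | rewrite big_ord_recl add0r].
- by exists h; split=> [|i|i wi]; [exact: wh | exact: wh i.+1 | exact: lh i.+1 wi].
Qed.

Definition shift (e : E) : E := projT1 (cid (shift_ex e)).

Lemma weight_shift0 e : weight (shift e) 0 = 0.
Proof. by rewrite /shift; case: cid => h []. Qed.

Lemma weight_shiftS e i : weight (shift e) i.+1 = weight e i.
Proof. by rewrite /shift; case: cid => h []. Qed.

Lemma label_shiftS e i : weight e i != 0 -> label (shift e) i.+1 = label e i.
Proof. by rewrite /shift; case: cid => h [? ?]; exact. Qed.

Lemma shift_continuous : continuous shift.
Proof.
apply: continuous_EG => -[|i] V oV.
- have [V0|V0] := pselect (V 0).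
    rewrite (_ : mkset _ = setT); first exact: openT.
    by apply/seteqP; split=> // e _ /=; rewrite weight_shift0.
  rewrite (_ : mkset _ = set0); first exact: open0.
  by apply/seteqP; split=> // e /=; rewrite weight_shift0.
- rewrite (_ : mkset _ = (fun e => weight e i) @^-1` V).
    by apply: open_comp => // ? _; exact: weight_continuous.
  by apply/seteqP; split=> e /=; rewrite weight_shiftS.
- rewrite (_ : mkset _ = set0); first exact: open0.
  by apply/seteqP; split=> // e /=; rewrite weight_shift0 eqxx => -[].
- rewrite (_ : mkset _ = [set e | weight e i != 0 /\ V (label e i)]).
    exact: open_label.
  by apply/seteqP; split=> e /= [];
    rewrite weight_shiftS => wi; rewrite label_shiftS.
Qed.

(** The fraction of the weight of slot [i] that has not yet been moved to slot
    [i.+1] at time [t]: it decreases affinely from [1] at time [2^-(i+1)] to [0]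
    at time [2^-i], and is constant outside that interval. *)
Definition kept (t : I) (i : nat) : R := uval (uclip (2 - 2 ^+ i.+1 * uval t)).

Lemma kept_ge0 t i : 0 <= kept t i.
Proof. by have /andP[] := uval_itv (uclip (2 - 2 ^+ i.+1 * uval t)). Qed.

Lemma kept_le1 t i : kept t i <= 1.
Proof. by have /andP[] := uval_itv (uclip (2 - 2 ^+ i.+1 * uval t)). Qed.

Lemma kept_continuous i : continuous (kept^~ i).
Proof.
have carg : continuous (fun t : I => 2 - 2 ^+ i.+1 * uval t).
  apply: continuous_subr; first exact: cst_continuous.
  by apply: continuous_mulr; [exact: cst_continuous | exact: uval_continuous].
exact: continuous_compT (continuous_compT carg (@uclip_continuous R))
  (@uval_continuous R).
Qed.

Lemma kept0 i : kept zero i = 1.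
Proof.
by rewrite /kept (uval0 R) mulr0 subr0 /uval /= min_l ?max_r ?ler1n.
Qed.

Lemma kept1 i : kept one i = 0.
Proof.
rewrite /kept (uval1 R) mulr1 /uval /= max_l // ge_min subr_le0 orbC.
by rewrite exprS ler_peMr // exprn_ege1 // ler1n.
Qed.

(** Slot [i] starts to be emptied only when slot [i.+1] is empty, so that two
    summands with different labels never share a slot. *)
Lemma kept_before t i : kept t i.+1 != 0 -> kept t i = 1.
Proof.
move=> ki; have arg_gt0 : 0 < 2 - 2 ^+ i.+2 * uval t.
  rewrite ltNge; apply: contraNN ki => arg_le0.
  by rewrite /kept /uval /= max_l // ge_min arg_le0 orbT.
have : 2 ^+ i.+1 * uval t <= 1.
  by move: arg_gt0; rewrite subr_gt0 exprS -mulrA gtr_pMr ?ltr0n // => /ltW.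
move=> le1; rewrite /kept /uval /= min_l ?max_r //.
by rewrite lerBrDr -lerBrDl (le_trans le1) // -[2]/(1 + 1) addrK.
Qed.

(** What slot [i] has received at time [t], as a fraction of the initial weight of
    its left neighbour; slot [0] has none. *)
Definition moved (t : I) (i : nat) : R := if i is j.+1 then 1 - kept t j else 0.

Lemma id_homotopic_shift : homotopic R (@idfun E) shift.
Proof.
apply: (@combination_homotopic kept moved idfun shift).
- exact: kept_continuous.
- move=> [|i]; first exact: cst_continuous.
  by apply: continuous_subr; [exact: cst_continuous | exact: kept_continuous].
- exact: kept_ge0.
- by move=> t [|i] //=; rewrite subr_ge0 kept_le1.
- by move=> ?; exact: cvg_id.
- exact: shift_continuous.
- move=> t e [|i] /=; first by right; rewrite mul0r.
  have [->|/kept_before ->] := eqVneq (kept t i.+1) 0; first by left; rewrite mul0r.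
  by right; rewrite subrr mul0r.
- move=> t e; have [n [wn w1]] := weight_mass1 e; exists n.+1; split.
    move=> [|i] // ni /=; rewrite weight_shiftS !wn ?mulr0 ?addr0 //.
    exact: ltnW.
  (* The weight leaving slot [i] is the weight arriving in slot [i.+1]. *)
  rewrite big_split big_ord_recr /= (wn n) // mulr0 addr0.
  rewrite [X in _ + X]big_ord_recl /= mul0r add0r -big_split /= -[RHS]w1.
  apply: eq_bigr => i _; rewrite weight_shiftS -mulrDl.
  by rewrite addrC subrK mul1r.
- move=> e i; rewrite kept0 mul1r /=.
  have -> : moved zero i = 0 by case: i => //= i; rewrite kept0 subrr.
  by rewrite mul0r addr0; split=> //; rewrite eqxx.
- (* At time [1] everything has moved; slot [0] of [shift e] is empty, which
     agrees with [moved one 0 = 0]. *)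
  move=> e i; rewrite kept1 mul0r add0r; split=> //; last by rewrite eqxx.
  case: i => [|i] /=; first by rewrite weight_shift0 mulr0.
  by rewrite kept1 subr0 mul1r.
Qed.

Lemma vertex_ex : exists v : E, weight v 0 = 1 /\ forall i, weight v i.+1 = 0.
Proof.
have [|| v [wv _]] := @EG_ex (fun i => (i == 0)%:R) (fun=> 1%g).
- by move=> i; exact: ler0n.
- by exists 1; split=> [[]//|]; rewrite big_ord1.
- by exists v; split=> [|i]; rewrite wv.
Qed.

(** Slot [0] is the only one occupied by [v] and is empty in [shift e], so the
    two can be joined by a segment. *)
Lemma shift_homotopic_vertex (v : E) :
    weight v 0 = 1 -> (forall i, weight v i.+1 = 0) ->
  homotopic R shift (fun=> v).
Proof.
move=> v0 vS.
apply: (@combination_homotopic (fun t _ => uval t) (fun t _ => 1 - uval t)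
          (fun=> v) shift).
- by move=> _; exact: uval_continuous.
- by move=> _; apply: continuous_subr; [exact: cst_continuous | exact: uval_continuous].
- by move=> t _; have /andP[] := uval_itv t.
- by move=> t _; rewrite subr_ge0; have /andP[] := uval_itv t.
- exact: cst_continuous.
- exact: shift_continuous.
- by move=> t e [|i]; [right; rewrite weight_shift0 mulr0 | left; rewrite vS mulr0].
- move=> t e; have [n [wn w1]] := weight_mass1 e; exists n.+1; split.
    by move=> [|i] // ni; rewrite vS weight_shiftS wn ?mulr0 ?addr0.
  rewrite big_ord_recl v0 weight_shift0 mulr1 mulr0 addr0.
  under eq_bigr do rewrite vS weight_shiftS mulr0 add0r.
  by rewrite -mulr_sumr w1 mulr1 addrC subrK.
- move=> e i; rewrite (uval0 R) mul0r add0r subr0 mul1r.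
  by split=> //; rewrite eqxx.
- move=> e i; rewrite (uval1 R) mul1r subrr mul0r addr0.
  by split=> //; rewrite eqxx.
Qed.

Lemma EG_contractible : contractible R E.
Proof.
have [v [v0 vS]] := vertex_ex; exists v.
exact: homotopic_trans id_homotopic_shift (shift_homotopic_vertex v0 vS).
Qed.

End MilnorSpace.

(** * The two fibrations *)

Theorem corollary5p11 (R : realType) :
  (forall (X : topologicalType) (x0 : X),
     path_connected R X ->
     E_strict_functor_pair R (@loop_incl R X x0) (@path_eval R X x0)) /\
  (forall (G : topologicalGroupType) (e : EG R G),
     E_strict_functor_pair R (@fiber_incl R G e) (@EG_proj R G)).
Proof.
split=> [X x0 _|G e]; apply: contractible_strict_functor_pair.
- exact: path_space_contractible.
- exact: const_loop.
- exact: EG_contractible.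
- exact: 1%g.
Qed.
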